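(* Let $(\nu(i))_{i\ge0}$ be a positive decreasing sequence such that $\sum_{i=0}^{\infty}\sqrt{\nu(i)/(i+1)}<\infty$ and $E((f(X_{i,m})-f(X_i))^2)\le \nu(i)$ for all integers $i,m\ge 0$. For $j\ge0$ put $\overline{\nu}(j)=\sum_{i=j}^{\infty}\sqrt{\nu(i)/(i+1)}$, and let $\mu=\lim_{h\to\infty}E(f(X_h))$ (which exists and is finite under these hypotheses). Let $(p_l)_{l\ge0}$ be a probability distribution on the non-negative integers with $p_l>0$ for all $l\ge0$. Then, for every $k\ge1$, $T_k\le3k\sum_{l=0}^\infty2^lp_l$, and $$k\,E(Z_k^2)\le2\big(\overline{\nu}(\lfloor b'(k)/2\rfloor)\big)^2\Big(\frac1{p_0}+\frac1{p_1}\Big)+\sum_{l=2}^\infty\frac{2^{3-l}\big(\overline{\nu}(k2^{l-2})-\overline{\nu}(k2^{l-1})\big)^2}{p_l}$$ (both bounds being possibly infinite). If the right-hand side of the last inequality is finite, then $Z_k$ is square-integrable and $E(f_{k,0}+Z_k)=\mu$.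
   Context: Setting: $F,F'$ are measurable spaces, $g:F\times F'\to F$ is measurable, $(U_i)_{i\in\mathbb Z}$ are i.i.d. $F'$-valued random variables, $X_0\in F$ is deterministic, and $X_{i+1}=g(X_i,U_i)$ for $i\ge0$. The function $f:F\to\mathbb R$ is measurable and $f(X_i)$ is square-integrable for every $i\ge0$. For $m\in\mathbb Z$, $(X_{i,m})_{i\ge -m}$ is defined by $X_{-m,m}=X_0$ and $X_{i+1,m}=g(X_{i,m},U_i)$ for $i\ge -m$; in particular $X_{i,0}=X_i$ for $i\ge0$. Estimators: for $k\ge1$ fix an integer $0\le b'(k)\le k/2$ and set $$f_{k,l}=\frac1{k-b'(k)}\sum_{i=b'(k)}^{k-1}f(X_{i,k(2^l-1)})\quad(l\ge0).$$ $N$ is a random variable independent of $(U_i)_{i\in\mathbb Z}$ with $\Pr(N=l)=p_l$ for $l\ge0$, and $Z_k=(f_{k,N+1}-f_{k,N})/p_N$. Cost model: simulating $f_{k,l}$ takes expected time $k2^l$, so the expected time $\tau_{k,l}$ to simulate $f_{k,l+1}-f_{k,l}$ satisfies $\tau_{k,l}\le k2^{l+1}+k2^l=3k2^l$. The expected time to simulate $Z_k$ is $T_k=\sum_{l\ge0}p_l\tau_{k,l}$. *)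

(* Defs.v *)
From HB Require Import structures.
From mathcomp Require Import all_boot all_order all_algebra.
From mathcomp Require Import all_classical all_reals all_analysis.

Set Implicit Arguments.
Unset Strict Implicit.
Unset Printing Implicit Defensive.

Import Order.TTheory GRing.Theory Num.Theory.
Import numFieldNormedType.Exports.

Local Open Scope classical_set_scope.
Local Open Scope ring_scope.

Section Independence.
Context d d' d'' (T : measurableType d) (T' : measurableType d')
  (T'' : measurableType d'') (R : realType) (P : probability T R) (I : choiceType).

Definition mutually_independent (U : I -> {RV P >-> T'}) : Prop :=
  forall (J : seq I) (A : I -> set T'), uniq J ->
    (forall j, measurable (A j)) ->
    P (\bigcap_(j in [set` J]) U j @^-1` A j) =
      (\prod_(j <- J) P (U j @^-1` A j))%E.

Definition identically_distributed (U : I -> {RV P >-> T'}) : Prop :=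
  forall (i j : I) (A : set T'), measurable A ->
    distribution P (U i) A = distribution P (U j) A.

Definition iid (U : I -> {RV P >-> T'}) : Prop :=
  mutually_independent U /\ identically_distributed U.

Definition sigma_family (U : I -> {RV P >-> T'}) : set (set T) :=
  <<s \bigcup_i g_sigma_algebra_preimage (U i) >>.

Definition independent_of_family (N : {RV P >-> T''})
    (U : I -> {RV P >-> T'}) : Prop :=
  forall A B : set T, g_sigma_algebra_preimage N A -> sigma_family U B ->
    P (A `&` B) = (P A * P B)%E.

End Independence.

Section Estimators.
Context d dF dF' (T : measurableType d) (F : measurableType dF)
  (F' : measurableType dF') (R : realType) (P : probability T R).
Variables (g : F * F' -> F) (U : int -> {RV P >-> F'}) (x0 : F).

Fixpoint chain (i : nat) (w : T) : F :=
  if i is i'.+1 then g (chain i' w, U i'%:Z w) else x0.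

Fixpoint chain_from (s : int) (n : nat) (w : T) : F :=
  if n is n'.+1 then g (chain_from s n' w, U (s + n'%:Z) w) else x0.

(* [shifted_chain i m] is the state at time [i] of the chain started from [x0]
   at time [-m]; it is meaningful only for [- m <= i]. *)
Definition shifted_chain (i m : int) : T -> F := chain_from (- m) (absz (i + m)).

Lemma shifted_chain_start (m : int) (w : T) : shifted_chain (- m) m w = x0.
Proof. by rewrite /shifted_chain addNr. Qed.

Lemma shifted_chain_step (i m : int) (w : T) : - m <= i ->
  shifted_chain (i + 1) m w = g (shifted_chain i m w, U i w).
Proof.
rewrite -subr_ge0 opprK => im; rewrite /shifted_chain addrAC.
have im' : (absz (i + m))%:Z = i + m by exact: gez0_abs.
have -> : absz (i + m + 1) = (absz (i + m)).+1.
  by rewrite -im' -PoszD absz_nat addn1.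
by rewrite /= im' [- m + _]addrC addrK.
Qed.

Lemma shifted_chain0 (i : nat) : shifted_chain i%:Z 0 = chain i.
Proof.
apply/funext => w; rewrite /shifted_chain addr0 absz_nat oppr0.
by elim: i => //= i ->; rewrite add0r.
Qed.

Variables (f : F -> R) (b' : nat -> nat).

Definition estimator (k l : nat) (w : T) : R :=
  (k - b' k)%:R^-1 *
    \sum_(b' k <= i < k) f (shifted_chain i%:Z (k * (2 ^ l - 1))%:Z w).

Definition randomized_estimator (p : nat -> R) (N : {RV P >-> nat}) (k : nat)
    (w : T) : R :=
  (estimator k (N w).+1 w - estimator k (N w) w) / p (N w).

End Estimators.

Section Costs.
Context (R : realType).

(* Cost model: expected time to simulate [estimator k l]. *)
Definition estimator_time (k l : nat) : R := (k * 2 ^ l)%:R.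

(* [tau k l] is the expected time to simulate the difference
   [estimator k l.+1 - estimator k l]. *)
Definition expected_time (p : nat -> R) (tau : nat -> nat -> R) (k : nat) : \bar R :=
  (\sum_(l <oo) (p l * tau k l)%:E)%E.

Definition nu_term (nu : nat -> R) (i : nat) : R := Num.sqrt (nu i / i.+1%:R).

(* A limit of real partial sums, hence meaningful only when
   [series (nu_term nu)] converges. *)
Definition nu_bar (nu : nat -> R) (j : nat) : R :=
  \big[+%R/0]_(j <= i <oo) nu_term nu i.

Definition second_moment_bound (nu p : nat -> R) (b' : nat -> nat) (k : nat) : \bar R :=
  ((2 * nu_bar nu (b' k %/ 2) ^+ 2 * ((p 0)^-1 + (p 1)^-1))%:E +
   \sum_(2 <= l <oo)
     ((2 : R) ^ (3 - l%:Z) *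
      (nu_bar nu (k * 2 ^ (l - 2)) - nu_bar nu (k * 2 ^ (l - 1))) ^+ 2 / p l)%:E)%E.

End Costs.

(* Main.v *)
Require Import Defs.
From HB Require Import structures.
From mathcomp Require Import all_boot all_order all_algebra.
From mathcomp Require Import all_classical all_reals all_analysis.
From mathcomp Require Import measurable_realfun.
From mathcomp Require Import ring lra zify.

Set Implicit Arguments.
Unset Strict Implicit.
Unset Printing Implicit Defensive.

Import Order.TTheory GRing.Theory Num.Theory.
Import numFieldNormedType.Exports.

Local Open Scope classical_set_scope.
Local Open Scope ring_scope.

(** Since the innovations are i.i.d., translating time by [m] turns the pair
    [(X_{i,m'}, X_{i,m})] with [m <= m'] into [(X_{i+m,m'-m}, X_{i+m})], so that
    [E (f X_{i,m'} - f X_{i,m})^2 <= nu (i + m)].  Minkowski's inequality then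
    bounds the L2 norm of [f_{k,l+1} - f_{k,l}] by the average of
    [sqrt (nu (i + k (2^l - 1)))] over [b' k <= i < k], which monotonicity of
    [nu] compares with [nu_bar].  Conditioning on [N] gives
    [E Z^2 = sum_l E (f_{k,l+1} - f_{k,l})^2 / p_l], and when this is finite
    [E Z] is the telescoping sum of the [E f_{k,l+1} - E f_{k,l}].  Time
    translation also gives [|E f X_{h+m} - E f X_h| <= sqrt (nu h)], so the
    means converge. *)

(** * Shift invariance of the innovations *)

Section ShiftInvariance.
Context (d dF dF' : measure_display) (T : measurableType d)
  (F : measurableType dF) (F' : measurableType dF')
  (R : realType) (P : probability T R).

Definition cylinder (J : seq nat) (A : nat -> set F') : set (nat -> F') :=
  \bigcap_(j in [set` J]) [set u | A j (u j)].

(** Finite-dimensional cylinders: the pi-system that generates the product sigma-algebra on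
    sequences of innovations. *)
Definition cylinders : set (set (nat -> F')) :=
  [set B | exists J A, [/\ uniq J, forall j, measurable (A j) & B = cylinder J A]].

Lemma setI_closed_cylinders : setI_closed cylinders.
Proof.
move=> _ _ [J [A [uJ mA ->]]] [K [B [uK mB ->]]].
(* A coordinate outside one of the two lists is left free by padding with [setT]. *)
exists (undup (J ++ K)), (fun j => (if j \in J then A j else setT) `&`
  (if j \in K then B j else setT)); split; first exact: undup_uniq.
  by move=> j; apply: measurableI; case: ifP.
apply/seteqP; split=> u.
- move=> [uA uB] j /= _; split; case: ifP => // jJ; [exact: uA | exact: uB].
- move=> H; split=> j /= jJ; (have /H : j \in undup (J ++ K)
    by rewrite mem_undup mem_cat jJ ?orbT); by rewrite /= jJ => -[].
Qed.

Local Notation innovations := (g_sigma_algebraType cylinders).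

Lemma measurable_coordinate (j : nat) :
  measurable_fun setT (fun u : innovations => u j).
Proof.
move=> _ A mA; rewrite setTI; apply: sub_sigma_algebra.
exists [:: j], (fun=> A); split=> //.
apply/seteqP; split=> u /= => [uA i /=|]; last by apply; rewrite /= inE.
by rewrite inE => /eqP ->.
Qed.

Variables (U : int -> {RV P >-> F'}).

(** The innovations seen from time [s] on, as one random sequence; shift invariance says that its
    law does not depend on [s]. *)
Definition innovations_from (s : int) (w : T) : innovations :=
  fun j => U (s + j%:Z) w.

Lemma measurable_innovations_from (s : int) :
  measurable_fun setT (innovations_from s).
Proof.
apply: (@measurability _ _ T innovations setT _ cylinders) => //.
move=> _ [_ [J [A [uJ mA ->]]] <-].
rewrite setTI /cylinder preimage_bigcap.
apply: bigcap_measurableType => j _.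
by rewrite -[_ @^-1` _]setTI; apply: measurable_funP.
Qed.

HB.instance Definition _ (s : int) := isMeasurableFun.Build _ _ _ _
  (innovations_from s) (measurable_innovations_from s).

Hypothesis iidU : iid U.

(** The right-hand side is free of [s], so the laws for different [s] agree on the pi-system of
    cylinders. *)
Lemma innovations_from_cylinder (s : int) (J : seq nat) (A : nat -> set F') :
  uniq J -> (forall j, measurable (A j)) ->
  distribution P (innovations_from s) (cylinder J A) =
    (\prod_(j <- J) distribution P (U 0) (A j))%E.
Proof.
move=> uJ mA; have [indep id_U] := iidU.
(* Reindexes [A] by absolute time. For indices below [s] the value is meaningless, but only indices
   [s + j] with [j] in [J] occur. *)
pose B (j : int) := A (absz (j - s)).
have BE j : B (s + j%:Z) = A j by rewrite /B addrAC subrr add0r absz_nat.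
have uK : uniq [seq s + j%:Z | j <- J] by rewrite map_inj_uniq// => i j /addrI [].
have := indep _ B uK (fun j => mA _).
rewrite big_map; under eq_bigr => j _ do rewrite BE.
move=> HK; under [in RHS]eq_bigr => j _ do rewrite (id_U 0 (s + j%:Z))//.
rewrite -[RHS]HK; congr (P _); apply/seteqP; split=> w /=.
- by move=> H _ /mapP [j jJ ->]; rewrite BE; exact: H.
- by move=> H j jJ /=; rewrite -BE; apply: H; apply: map_f.
Qed.

Lemma innovations_from_law (s t : int) (B : set innovations) : measurable B ->
  distribution P (innovations_from s) B = distribution P (innovations_from t) B.
Proof.
apply: (@measure_unique _ R innovations cylinders (fun=> setT)) => //.
- exact: setI_closed_cylinders.
- by move=> _; exists [::], (fun=> setT); split=> //; apply/seteqP; split.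
- by apply/seteqP; split=> // u _; exists 0%N.
- by move=> _ [J [A [uJ mA ->]]];
    rewrite [LHS]innovations_from_cylinder// [RHS]innovations_from_cylinder.
- by move=> _; rewrite (le_lt_trans (probability_le1 _ _)) ?ltry.
Qed.

Lemma ge0_integral_innovations_from (s t : int) (h : innovations -> \bar R) :
  measurable_fun setT h -> (forall u, 0 <= h u)%E ->
  (\int[P]_w h (innovations_from s w) = \int[P]_w h (innovations_from t w))%E.
Proof.
move=> mh h0.
rewrite -(ge0_integral_distribution (innovations_from s) mh h0).
rewrite -(ge0_integral_distribution (innovations_from t) mh h0).
by apply: eq_measure_integral => A mA _; exact: innovations_from_law.
Qed.

Lemma integral_innovations_from (s t : int) (h : innovations -> \bar R) :
  measurable_fun setT h ->
  (\int[P]_w h (innovations_from s w) = \int[P]_w h (innovations_from t w))%E.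
Proof.
move=> mh; rewrite [LHS]integralE [RHS]integralE.
rewrite !(funepos_comp h (innovations_from _)) !(funeneg_comp h (innovations_from _)).
congr (_ - _)%E.
- apply: (ge0_integral_innovations_from s t (h := h^\+%E)) => //.
  exact: measurable_funepos.
- apply: (ge0_integral_innovations_from s t (h := h^\-%E)) => //.
  exact: measurable_funeneg.
Qed.

Variables (g : F * F' -> F) (mg : measurable_fun setT g) (x0 : F).

(** The chain as a deterministic function of an innovation sequence, started at offset [r]. The
    offset lets chains with different starting times be read off the same sequence. *)
Fixpoint trajectory (r n : nat) (u : nat -> F') : F :=
  if n is n'.+1 then g (trajectory r n' u, u (r + n')%N) else x0.

Lemma measurable_trajectory (r n : nat) :
  measurable_fun setT (trajectory r n : innovations -> F).
Proof.
elim: n => [|n IH]; first exact: measurable_cst.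
apply: (measurableT_comp mg); apply: measurable_fun_pair => //.
exact: measurable_coordinate.
Qed.

Lemma chain_from_trajectory (s : int) (r n : nat) :
  chain_from g U x0 (s + r%:Z) n = trajectory r n \o innovations_from s.
Proof.
apply/funext => w /=; elim: n => //= n ->.
by rewrite /innovations_from PoszD addrA.
Qed.

(** Both chains are functions of the same [innovations_from s], so a time shift preserves their
    joint law and not only the two marginals. *)
Lemma integral_chain_from_shift (h : F * F -> \bar R) (s t : int)
    (r n q m : nat) : measurable_fun setT h ->
  (\int[P]_w h (chain_from g U x0 (s + r%:Z) n w, chain_from g U x0 (s + q%:Z) m w) =
   \int[P]_w h (chain_from g U x0 (t + r%:Z) n w, chain_from g U x0 (t + q%:Z) m w))%E.
Proof.
move=> mh; rewrite !chain_from_trajectory.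
apply: (integral_innovations_from s t
  (h := fun u => h (trajectory r n u, trajectory q m u))).
by apply: (measurableT_comp mh); apply: measurable_fun_pair; exact: measurable_trajectory.
Qed.

Lemma sigma_family_sub : sigma_family U `<=` measurable.
Proof.
apply: smallest_sub; first exact: sigma_algebra_measurable.
by move=> _ [i _ [B mB <-]]; apply: measurable_funP.
Qed.

(** The sample space with the sigma-algebra generated by the innovations; measurability from it is
    the form in which independence of [N] gets used. *)
Local Notation sigmaU :=
  (g_sigma_algebraType (\bigcup_i g_sigma_algebra_preimage (U i))).

Lemma sigma_family_measurable_fun d1 (S : measurableType d1) (Y : T -> S) :
  measurable_fun setT (Y : sigmaU -> S) -> measurable_fun setT Y.
Proof. by move=> mY _ A mA; apply: sigma_family_sub; exact: mY. Qed.

Lemma sigma_family_chain_from (s : int) (n : nat) :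
  measurable_fun setT (chain_from g U x0 s n : sigmaU -> F).
Proof.
elim: n => [|n IH]; first exact: measurable_cst.
apply: (measurableT_comp mg); apply: measurable_fun_pair => //.
move=> _ A mA; rewrite setTI; apply: sub_sigma_algebra.
by exists (s + n%:Z) => //; exists A => //; rewrite setTI.
Qed.

End ShiftInvariance.

(** * Integration over an event independent of the innovations *)

Section Independence.
Context (d dF' : measure_display) (T : measurableType d)
  (F' : measurableType dF') (R : realType) (P : probability T R).

(** The restricted measure equals [P] inside [A] and vanishes on the complement. This turns an
    integral over an event into one over the whole space, so that independence becomes an equality
    of measures. *)
Lemma ge0_integral_mrestr (A : set T) (mA : measurable A) (h : T -> \bar R) :
  measurable_fun setT h -> (forall x, 0 <= h x)%E ->
  (\int[mrestr P mA]_w h w = \int[P]_(w in A) h w)%E.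
Proof.
move=> mh h0.
rewrite -(setUv A) ge0_integral_setU//=; last 3 first.
- exact: measurableC.
- by rewrite setUv.
- by apply/disj_set2P; rewrite setICr.
rewrite (eq_measure_integral P); last first.
  by move=> B mB BA; rewrite /= /mrestr setIidl.
rewrite [X in (_ + X)%E](eq_measure_integral mzero) ?integral_measure_zero ?adde0//.
move=> B mB BA; rewrite /= /mrestr (_ : B `&` A = set0) ?measure0//.
exact/disj_set2P/disj_setPLR.
Qed.

Context (dS : measure_display) (S : measurableType dS).
Variables (U : int -> {RV P >-> F'}) (N : {RV P >-> S}).
Hypothesis N_indep : independent_of_family N U.
Local Notation sigmaU :=
  (g_sigma_algebraType (\bigcup_i g_sigma_algebra_preimage (U i))).

Lemma ge0_integral_independent (C : set S) dY (Y' : measurableType dY) (Y : T -> Y')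
    (h : Y' -> \bar R) :
  measurable C -> measurable_fun setT (Y : sigmaU -> Y') ->
  measurable_fun setT h -> (forall x, 0 <= h x)%E ->
  (\int[P]_(w in N @^-1` C) h (Y w) = P (N @^-1` C) * \int[P]_w h (Y w))%E.
Proof.
move=> mC mYU mh h0; have mY := sigma_family_measurable_fun mYU.
have mA : measurable (N @^-1` C) by rewrite -[_ @^-1` _]setTI; apply: measurable_funP.
have mhY : measurable_fun setT (h \o Y) := measurableT_comp mh mY.
rewrite -(ge0_integral_mrestr mA mhY); last by move=> x; exact: h0.
have fP : P (N @^-1` C) \is a fin_num by exact: fin_num_measure.
have pE : (fine (P (N @^-1` C)))%:E = P (N @^-1` C) by rewrite fineK.
have p0 : 0 <= fine (P (N @^-1` C)) by rewrite fine_ge0.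
have := ge0_integral_mscale P measurableT (NngNum p0) mhY (fun x _ => h0 (Y x)).
rewrite /= pE => <-.
have E m := @ge0_integral_pushforward _ _ _ _ _ _ mY m setT h measurableT mh
  (fun u _ => h0 u).
have := E (mrestr P mA).
rewrite preimage_setT => <-; have := E (mscale (NngNum p0) P).
rewrite preimage_setT => <-.
apply: eq_measure_integral => B mB _; rewrite /= /mrestr /mscale /=.
rewrite /pushforward pE setIC.
apply: N_indep; first by exists C => //; rewrite setTI.
by rewrite -[_ @^-1` _]setTI; exact: mYU.
Qed.

Lemma integral_independent (C : set S) dY (Y' : measurableType dY) (Y : T -> Y')
    (h : Y' -> \bar R) :
  measurable C -> measurable_fun setT (Y : sigmaU -> Y') ->
  measurable_fun setT h -> P.-integrable setT (h \o Y) ->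
  (\int[P]_(w in N @^-1` C) h (Y w) = P (N @^-1` C) * \int[P]_w h (Y w))%E.
Proof.
move=> mC mYU mh ih; rewrite [LHS]integralE [in RHS]integralE.
rewrite !(funepos_comp h Y) !(funeneg_comp h Y).
have -> : (\int[P]_(w in N @^-1` C) (h^\+ \o Y) w =
    P (N @^-1` C) * \int[P]_w (h^\+ \o Y) w)%E.
  apply: (ge0_integral_independent mC mYU (h := h^\+%E)) => //.
  exact: measurable_funepos.
have -> : (\int[P]_(w in N @^-1` C) (h^\- \o Y) w =
    P (N @^-1` C) * \int[P]_w (h^\- \o Y) w)%E.
  apply: (ge0_integral_independent mC mYU (h := h^\-%E)) => //.
  exact: measurable_funeneg.
have mA : measurable (N @^-1` C) by rewrite -[_ @^-1` _]setTI; apply: measurable_funP.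
(* Distributing over the difference requires that it is not of the form infinity minus infinity;
   integrability of [h \o Y] ensures this. *)
rewrite [RHS]muleBr ?fin_num_measure//.
rewrite fin_num_adde_defr// -funepos_comp integrable_fin_num//.
exact: integrable_funepos.
Qed.
End Independence.

(** * Comparison of averages of [sqrt nu] with [nu_bar] *)

Section FiniteSums.
Context (R : rcfType).

(* Cauchy-Schwarz in Engel form. With the weights [c i] bounding the L2 norms of
   the [a i], it gives Minkowski's inequality without square roots of integrals. *)
Lemma sqr_sum_le_weighted (m n : nat) (a c : nat -> R) : (forall i, 0 < c i) ->
  (\sum_(m <= i < n) a i) ^+ 2 <=
    (\sum_(m <= i < n) c i) * \sum_(m <= i < n) a i ^+ 2 / c i.
Proof.
move=> c0; have [mn|nm] := ltnP m n; last by rewrite !big_geq// expr0n mul0r.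
set A := \sum_(m <= i < n) a i; set C := \sum_(m <= i < n) c i.
have C0 : 0 < C.
  rewrite /C big_ltn// ltr_pwDl//; apply: sumr_ge0 => i _; exact: ltW.
(* This quadratic in [t] is the sum of the [(a i - t * c i) ^+ 2 / c i]; it is evaluated below at
   its minimiser [A / C]. *)
have H t : 0 <= \sum_(m <= i < n) a i ^+ 2 / c i - (2 * t) * A + t ^+ 2 * C.
  rewrite /A /C !mulr_sumr -sumrB -big_split /=; apply: sumr_ge0 => i _.
  rewrite (_ : _ + _ = (a i - t * c i) ^+ 2 / c i); last by field; rewrite gt_eqF.
  by rewrite divr_ge0 ?sqr_ge0// ltW.
have := H (A / C).
rewrite (_ : _ + _ = \sum_(m <= i < n) a i ^+ 2 / c i - A ^+ 2 / C); last first.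
  by field; rewrite gt_eqF.
by rewrite subr_ge0 ler_pdivrMr// mulrC.
Qed.

Lemma sum_nonincreasing_le (s : nat -> R) (b k : nat) : nonincreasing_seq s ->
  (b <= k)%N -> \sum_(b <= i < k) s i <= (k - b)%:R * s b.
Proof.
move=> ds bk; rewrite mulr_natl -sumr_const_nat.
by apply: ler_sum_nat => i /andP[bi _]; exact: ds.
Qed.

Lemma sum_nonincreasing_ge (s : nat -> R) (c b : nat) : nonincreasing_seq s ->
  (c <= b)%N -> (b - c)%:R * s b <= \sum_(c <= i < b) s i.
Proof.
move=> ds bk; rewrite mulr_natl -sumr_const_nat.
by apply: ler_sum_nat => i /andP[_ /ltnW bi]; exact: ds.
Qed.

(** Extending the range of an average to earlier indices can only increase it: terms before [b] are
    at least [s b], later ones at most [s b]. Stated without division. *)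
Lemma average_nonincreasing (s : nat -> R) (c b k : nat) :
  nonincreasing_seq s -> (c <= b)%N -> (b <= k)%N ->
  (k - c)%:R * \sum_(b <= i < k) s i <= (k - b)%:R * \sum_(c <= i < k) s i.
Proof.
move=> ds cb bk; rewrite [in leRHS](@big_cat_nat _ _ _ b)//= mulrDr.
have -> : (k - c)%:R = (k - b)%:R + (b - c)%:R :> R by rewrite -natrD; congr _%:R; lia.
rewrite mulrDl addrC lerD2r.
have H1 := sum_nonincreasing_le ds bk; have H2 := sum_nonincreasing_ge ds cb.
apply: le_trans (_ : (b - c)%:R * ((k - b)%:R * s b) <= _); first by rewrite ler_wpM2l.
by rewrite mulrCA ler_wpM2l.
Qed.

Variable nu : nat -> R.
Hypotheses (nu_ge0 : forall i, 0 <= nu i) (nu_dec : nonincreasing_seq nu).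

Lemma sqrt_nonincreasing : nonincreasing_seq (Num.sqrt \o nu).
Proof. by move=> i j ij /=; rewrite ler_wsqrtr// nu_dec. Qed.

(** Each [sqrt (nu i)] is [sqrt (i + 1)] times the corresponding term on the right, and
    [i + 1 <= k]. *)
Lemma sum_sqrt_nu_le (c k : nat) :
  \sum_(c <= i < k) Num.sqrt (nu i) <=
    Num.sqrt k%:R * \sum_(c <= i < k) Num.sqrt (nu i / i.+1%:R).
Proof.
rewrite mulr_sumr; apply: ler_sum_nat => i /andP[_ ik].
rewrite sqrtrM// sqrtrV// mulrCA ler_peMr ?sqrtr_ge0//.
by rewrite ler_pdivlMr ?sqrtr_gt0// mul1r ler_wsqrtr// ler_nat.
Qed.

(** By monotonicity, [k * sqrt (nu k)] is at most the sum of the first [k] values of [sqrt nu]; then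
    one factor [sqrt k] cancels. *)
Lemma sqrt_nu_le (k : nat) :
  Num.sqrt k%:R * Num.sqrt (nu k) <= \sum_(0 <= i < k) Num.sqrt (nu i / i.+1%:R).
Proof.
have [->|k0] := posnP k; first by rewrite sqrtr0 mul0r big_geq.
have k0' : 0 < Num.sqrt k%:R :> R by rewrite sqrtr_gt0 ltr0n.
rewrite -(ler_pM2l k0') (le_trans _ (sum_sqrt_nu_le 0 k))//.
rewrite mulrA -expr2 sqr_sqrtr//.
by have := sum_nonincreasing_ge sqrt_nonincreasing (leq0n k); rewrite subn0.
Qed.

(** The shift [m] is dropped by monotonicity, and the average from [b] is compared with the longer
    one from [b %/ 2]. Keeping the range from [b], the same estimates would give the constant 4; the
    longer range brings it down to 2. *)
Lemma early_blocks_bound (b k m : nat) : (1 <= k)%N -> (2 * b <= k)%N ->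
  k%:R * ((k - b)%:R^-1 * \sum_(b <= i < k) Num.sqrt (nu (i + m)%N)) ^+ 2 <=
    2 * (\sum_(b %/ 2 <= i < k) Num.sqrt (nu i / i.+1%:R)) ^+ 2.
Proof.
move=> k0 bk; set c := (b %/ 2)%N; set n := (k - b)%N.
set V := \sum_(c <= i < k) _.
have n0 : 0 < n%:R :> R by rewrite ltr0n /n; lia.
set S := \sum_(b <= i < k) Num.sqrt (nu i).
have S0 : 0 <= S by apply: sumr_ge0 => i _; exact: sqrtr_ge0.
have V0 : 0 <= V by apply: sumr_ge0 => i _; exact: sqrtr_ge0.
have SmS : \sum_(b <= i < k) Num.sqrt (nu (i + m)%N) <= S.
  by apply: ler_sum => i _; apply: sqrt_nonincreasing; exact: leq_addr.
apply: le_trans (_ : k%:R * (n%:R^-1 * S) ^+ 2 <= _).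
  rewrite ler_wpM2l// ler_pXn2r// ?nnegrE ?mulr_ge0 ?invr_ge0//.
  - by rewrite ler_wpM2l ?invr_ge0.
  - by apply: sumr_ge0 => i _; exact: sqrtr_ge0.
have cb : (c <= b)%N by rewrite /c; lia.
have H : (k - c)%:R * S <= n%:R * (Num.sqrt k%:R * V).
  apply: le_trans (average_nonincreasing sqrt_nonincreasing cb _) _; first by lia.
  by rewrite ler_wpM2l// sum_sqrt_nu_le.
have H2 : (k - c)%:R ^+ 2 * S ^+ 2 <= n%:R ^+ 2 * (k%:R * V ^+ 2).
  have -> : n%:R ^+ 2 * (k%:R * V ^+ 2) = (n%:R * (Num.sqrt k%:R * V)) ^+ 2.
    by rewrite !exprMn sqr_sqrtr.
  by rewrite -exprMn ler_pXn2r// ?nnegrE ?mulr_ge0 ?sqrtr_ge0.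
(* [(k - c)^2 >= k (k - 2 c) >= k (k - b)] is where halving [b] is used. *)
have H3 : k%:R * n%:R <= (k - c)%:R ^+ 2 :> R.
  by rewrite -natrM -natrX ler_nat /n /c; nia.
(* The constant 2 of the bound comes from here, since [b] is at most half of [k]. *)
have H4 : k%:R <= 2 * n%:R :> R by rewrite -natrM ler_nat /n; lia.
have k0' : 0 < k%:R :> R by rewrite ltr0n.
have H5 : S ^+ 2 <= n%:R * V ^+ 2.
  have kn0 : 0 < k%:R * n%:R :> R by rewrite mulr_gt0.
  rewrite -(ler_pM2l kn0).
  apply: le_trans (_ : (k - c)%:R ^+ 2 * S ^+ 2 <= _).
    by rewrite ler_wpM2r ?sqr_ge0.
  by rewrite (le_trans H2)// le_eqVlt; apply/orP; left; apply/eqP; ring.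
have n20 : 0 < n%:R ^+ 2 :> R by rewrite exprn_gt0.
rewrite (_ : k%:R * _ = (k%:R * S ^+ 2) / n%:R ^+ 2); last first.
  by field; rewrite gt_eqF.
rewrite ler_pdivrMr//.
apply: le_trans (_ : (2 * n%:R) * (n%:R * V ^+ 2) <= _).
  by apply: ler_pM => //; rewrite sqr_ge0.
by rewrite le_eqVlt; apply/orP; left; apply/eqP; ring.
Qed.

(** With [K = k * 2 ^ (l - 2)], every index in the average is at least [2 K], so the average is at
    most [s = sqrt (nu (2 K))]. In turn [s] is at most each [sqrt (nu i)] with [K <= i < 2 K],
    whence [K * s ^+ 2 <= 2 * V ^+ 2], where [V] is the sum on the right. *)
Lemma late_blocks_bound (b k l : nat) : (1 <= k)%N -> (2 * b <= k)%N -> (2 <= l)%N ->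
  k%:R * ((k - b)%:R^-1 *
      \sum_(b <= i < k) Num.sqrt (nu (i + k * (2 ^ l - 1))%N)) ^+ 2 <=
    (2 : R) ^ (3 - l%:Z) *
      (\sum_(k * 2 ^ (l - 2) <= i < k * 2 ^ (l - 1))
         Num.sqrt (nu i / i.+1%:R)) ^+ 2.
Proof.
(* From here on [l] stands for the original level minus 2. *)
move=> k0 bk; case: l => [|[|l]]// _; rewrite subn2 subn1 /=.
set K := (k * 2 ^ l)%N.
have K2 : (k * 2 ^ l.+1)%N = (K + K)%N by rewrite /K expnS; lia.
have K0 : 0 < K%:R :> R by rewrite ltr0n /K muln_gt0 k0 expn_gt0.
rewrite K2; set s := Num.sqrt (nu (K + K)%N).
have s0 : 0 <= s := sqrtr_ge0 _.
have n0 : 0 < (k - b)%:R :> R by rewrite ltr0n; lia.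
have k0' : 0 < k%:R :> R by rewrite ltr0n.
apply: le_trans (_ : k%:R * s ^+ 2 <= _).
  rewrite ler_wpM2l// ler_pXn2r// ?nnegrE//; last first.
    by rewrite mulr_ge0 ?invr_ge0//; apply: sumr_ge0 => i _; exact: sqrtr_ge0.
  rewrite mulrC ler_pdivrMr// mulrC mulr_natl -sumr_const_nat.
  apply: ler_sum_nat => i _; apply: sqrt_nonincreasing.
  have : (1 <= 2 ^ l)%N by rewrite expn_gt0.
  by rewrite /K !expnS; nia.
set V := \sum_(_ <= i < _) _.
have V0 : 0 <= V by apply: sumr_ge0 => i _; exact: sqrtr_ge0.
have H : K%:R * s <= Num.sqrt (K + K)%:R * V.
  have := sum_nonincreasing_ge sqrt_nonincreasing (leq_addr K K).
  rewrite addKn => H.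
  exact: le_trans H (sum_sqrt_nu_le _ _).
have H2 : K%:R ^+ 2 * s ^+ 2 <= (K + K)%:R * V ^+ 2.
  have -> : (K + K)%:R * V ^+ 2 = (Num.sqrt (K + K)%:R * V) ^+ 2.
    by rewrite exprMn sqr_sqrtr.
  by rewrite -exprMn ler_pXn2r// ?nnegrE ?mulr_ge0 ?sqrtr_ge0.
have {}H2 : K%:R * s ^+ 2 <= 2 * V ^+ 2.
  rewrite -(ler_pM2l K0) mulrA -expr2 (le_trans H2)//.
  by rewrite natrD le_eqVlt; apply/orP; left; apply/eqP; ring.
have l0 : 0 < (2 : R) ^+ l by rewrite exprn_gt0.
have -> : (2 : R) ^ (3 - l.+2%:Z) = 2 / 2 ^+ l.
  rewrite (_ : 3 - l.+2%:Z = 1 - l%:Z); last by lia.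
  by rewrite expfzDr ?pnatr_eq0// expr1z -invr_expz.
rewrite mulrAC ler_pdivlMr// (le_trans _ H2)//.
by rewrite /K natrM natrX mulrAC.
Qed.

End FiniteSums.

(** * Tails of the convergent series behind [nu_bar] *)

Section NuBar.
Context (R : realType) (nu : nat -> R).
Hypotheses (nu_ge0 : forall i, 0 <= nu i) (nu_dec : nonincreasing_seq nu).
Hypothesis nu_sum : cvgn (series (nu_term nu)).

Lemma nu_barE (j : nat) :
  nu_bar nu j = limn (series (nu_term nu)) - series (nu_term nu) j.
Proof.
apply/cvg_lim => //.
apply: cvg_trans (_ :
  (fun n => series (nu_term nu) n - series (nu_term nu) j) @ \oo --> _).
  apply: near_eq_cvg; near=> n; rewrite sub_series_geq//.
  by near: n; exact: nbhs_infty_ge.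
by apply: cvgB => //; exact: cvg_cst.
Unshelve. all: by end_near. Qed.

Lemma nu_bar_sub (i j : nat) : (i <= j)%N ->
  nu_bar nu i - nu_bar nu j = \sum_(i <= h < j) nu_term nu h.
Proof. by move=> ij; rewrite !nu_barE -sub_series_geq//; ring. Qed.

Lemma sum_nu_term_le (i j : nat) : \sum_(i <= h < j) nu_term nu h <= nu_bar nu i.
Proof.
have nd : nondecreasing_seq (series (nu_term nu)).
  apply: nondecreasing_series => h _ _; exact: sqrtr_ge0.
have pos h : 0 <= nu_bar nu h.
  by rewrite nu_barE subr_ge0; exact: nondecreasing_cvgn_le.
have [ij|/ltnW ji] := leqP i j; last by rewrite big_geq.
by rewrite -nu_bar_sub// gerBl.
Qed.

(** The product [sqrt n * sqrt (nu n)] stays below [nu_bar nu 0], so [sqrt (nu n)] is at most [e]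
    once [n] exceeds [(nu_bar nu 0 / e) ^+ 2]. *)
Lemma sqrt_nu_cvg0 : Num.sqrt (nu n) @[n --> \oo] --> 0.
Proof.
apply/cvgrPdist_le => e e0; near=> n.
rewrite sub0r normrN ger0_norm ?sqrtr_ge0//.
have n0 : 0 < Num.sqrt n%:R :> R.
  by rewrite sqrtr_gt0 ltr0n; near: n; exact: nbhs_infty_gt.
rewrite -(ler_pM2l n0) (le_trans (sqrt_nu_le nu_ge0 nu_dec n))//.
rewrite (le_trans (sum_nu_term_le 0 n))// -ler_pdivrMr//.
have H : (nu_bar nu 0 / e) ^+ 2 <= n%:R.
  apply: ltW; near: n; exact: nbhs_infty_gtr.
by rewrite (le_trans (ler_norm _))// -sqrtr_sqr ler_wsqrtr.
Unshelve. all: by end_near. Qed.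

End NuBar.

(** * Second moments *)

Section SecondMoments.
Context (d : measure_display) (T : measurableType d) (R : realType)
  (P : probability T R).

Lemma integral_sqrZ (r : R) (Y : T -> R) : measurable_fun setT Y ->
  (\int[P]_w ((r * Y w) ^+ 2)%:E = (r ^+ 2)%:E * \int[P]_w (Y w ^+ 2)%:E)%E.
Proof.
move=> mY; rewrite -ge0_integralZl_EFin ?sqr_ge0//.
- by apply: eq_integral => w _; rewrite exprMn EFinM.
- by move=> w _; rewrite lee_fin sqr_ge0.
- exact/measurable_EFinP/measurable_funX.
Qed.

Lemma Lfun2_of_sqr (Y : T -> R) : measurable_fun setT Y ->
  (\int[P]_w (Y w ^+ 2)%:E < +oo)%E -> Y \in Lfun P 2%:E.
Proof.
move=> mY Yoo; rewrite inE; apply/andP; split; rewrite inE//=.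
rewrite /finite_norm unlock /= poweR_lty//.
rewrite (eq_integral (fun w => (Y w ^+ 2)%:E))// => w _.
by rewrite /= powR_mulrn// real_normK// num_real.
Qed.

Lemma integral_sqr_lty (Y : T -> R) : Y \in Lfun P 2%:E ->
  (\int[P]_w (Y w ^+ 2)%:E < +oo)%E.
Proof. by move=> /Lfun2_integrable_sqr/integrable_lty; exact. Qed.

Lemma Lfun2_1 (Y : T -> R) : Y \in Lfun P 2%:E -> Y \in Lfun P 1.
Proof. by apply: Lfun_subset12; exact: fin_num_measure. Qed.

Lemma sqr_expectation_le (Y : T -> R) (e : R) : Y \in Lfun P 2%:E ->
  ('E_P[Y] = e%:E)%E -> ((e ^+ 2)%:E <= \int[P]_w (Y w ^+ 2)%:E)%E.
Proof.
move=> Y2 Ee; have := variance_ge0 P Y; rewrite varianceE// Ee.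
by rewrite unlock -EFin_expe sube_ge0//.
Qed.

(** Minkowski's inequality, from integrating the pointwise weighted Cauchy-Schwarz bound: with [C]
    the sum of the [c i], term [i] contributes at most [C / c i * c i ^+ 2 = C * c i], and these add
    up to [C ^+ 2]. *)
Lemma integral_sqr_sum_le (m n : nat) (a : nat -> T -> R) (c : nat -> R) (r : R) :
  (forall i, measurable_fun setT (a i)) -> (forall i, 0 < c i) ->
  (forall i, (\int[P]_w (a i w ^+ 2)%:E <= (c i ^+ 2)%:E)%E) ->
  (\int[P]_w ((r * \sum_(m <= i < n) a i w) ^+ 2)%:E <=
     ((r * \sum_(m <= i < n) c i) ^+ 2)%:E)%E.
Proof.
move=> ma c0 ac.
have msum : measurable_fun setT (fun w => \sum_(m <= i < n) a i w).
  exact: measurable_sum.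
rewrite integral_sqrZ// exprMn [leRHS]EFinM.
apply: lee_wpmul2l; first by rewrite lee_fin sqr_ge0.
set C := \sum_(m <= i < n) c i.
have C0 : 0 <= C by apply: sumr_ge0 => i _; exact: ltW.
pose q i w := ((C / c i)%:E * (a i w ^+ 2)%:E)%E.
have mq i : measurable_fun setT (q i).
  by apply: measurable_funeM; exact/measurable_EFinP/measurable_funX.
have q0 i w : (0 <= q i w)%E by rewrite /q -EFinM lee_fin mulr_ge0 ?sqr_ge0 ?divr_ge0// ltW.
apply: le_trans (_ : (\int[P]_w (\sum_(m <= i < n) q i w) <= _)%E).
  apply: ge0_le_integral => //.
  - by move=> w _; rewrite lee_fin sqr_ge0.
  - exact/measurable_EFinP/measurable_funX.
  - exact: emeasurable_sum.
  - move=> w _; rewrite (eq_bigr (fun i => ((C / c i) * a i w ^+ 2)%:E))//.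
    rewrite sumEFin lee_fin (le_trans (sqr_sum_le_weighted _ _ _ c0))//.
    rewrite mulr_sumr; apply: ler_sum => i _.
    by rewrite mulrA mulrAC.
rewrite ge0_integral_sum// expr2 [in leRHS]/C mulr_sumr -sumEFin.
apply: lee_sum => i _.
rewrite ge0_integralZl_EFin//; last 3 first.
- by move=> w _; rewrite lee_fin sqr_ge0.
- exact/measurable_EFinP/measurable_funX.
- by rewrite divr_ge0// ltW.
apply: le_trans (lee_wpmul2l _ (ac i)) _; first by rewrite lee_fin divr_ge0// ltW.
rewrite -EFinM lee_fin le_eqVlt; apply/orP; left; apply/eqP.
by rewrite -/C; field; rewrite gt_eqF.
Qed.

End SecondMoments.

(** * Moments of a difference drawn at the random level [N] *)

Section Randomization.
Context (d dF' : measure_display) (T : measurableType d)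
  (F' : measurableType dF') (R : realType) (P : probability T R)
  (U : int -> {RV P >-> F'}) (N : {RV P >-> nat}) (p : nat -> R).
Hypotheses (N_indep : independent_of_family N U) (p_gt0 : forall l, 0 < p l).
Hypothesis (N_law : forall l, P (N @^-1` [set l]) = (p l)%:E).

Variable (D : nat -> T -> R).
Hypothesis mD : forall l, measurable_fun setT
  (D l : g_sigma_algebraType (\bigcup_i g_sigma_algebra_preimage (U i)) -> R).

Local Notation Z := (fun w => D (N w) w / p (N w)).

Let mDT l : measurable_fun setT (D l).
Proof. exact: sigma_family_measurable_fun (mD l). Qed.

Let mNl l : measurable (N @^-1` [set l]).
Proof. by rewrite -[_ @^-1` _]setTI; apply: measurable_funP. Qed.

Let bigcup_N : \bigcup_l (N @^-1` [set l]) = setT.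
Proof. by apply/seteqP; split=> // w _; exists (N w). Qed.

Let trivIset_N : trivIset setT (fun l => N @^-1` [set l]).
Proof.
apply/trivIsetP => i j _ _ /eqP ij; apply/seteqP; split=> w //= -[Ni Nj].
by apply: ij; rewrite -Ni -Nj.
Qed.

Lemma measurable_randomization : measurable_fun setT Z.
Proof.
rewrite -bigcup_N; apply/measurable_fun_bigcup => // l.
apply: (eq_measurable_fun (fun w => D l w / p l)).
  by move=> w; rewrite inE /= => ->.
by apply: measurable_funTS; apply: measurable_funM.
Qed.

(** The events [N = l] partition the space. On each the integrand is [D l ^+ 2 / p l ^+ 2], and
    independence yields a factor [p l], leaving one [(p l)^-1]. *)
Lemma integral_sqr_randomization :
  (\int[P]_w (Z w ^+ 2)%:E =
     \sum_(l <oo) ((p l)^-1)%:E * \int[P]_w (D l w ^+ 2)%:E)%E.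
Proof.
rewrite -[in LHS]bigcup_N ge0_integral_bigcup//; last 2 first.
- rewrite bigcup_N; apply/measurable_EFinP/measurable_funX.
  exact: measurable_randomization.
- by move=> w _; rewrite lee_fin sqr_ge0.
apply: eq_eseriesr => l _.
have -> : (\int[P]_(w in N @^-1` [set l]) (Z w ^+ 2)%:E =
    \int[P]_(w in N @^-1` [set l]) (((p l)^-1 * D l w) ^+ 2)%:E)%E.
  by apply: eq_integral => w; rewrite inE /= => ->; rewrite mulrC.
have mh : measurable_fun setT (fun x : R => (((p l)^-1 * x) ^+ 2)%:E).
  by apply/measurable_EFinP/measurable_funX; apply: measurable_funM.
rewrite (ge0_integral_independent N_indep _ (mD l) mh)//; last first.
  by move=> x; rewrite lee_fin sqr_ge0.
rewrite [in X in (X * _)%E]N_law integral_sqrZ// muleA -EFinM.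
congr ((_)%:E * _)%E.
by field; rewrite gt_eqF.
Qed.

(** Same partition; here the factor [p l] from independence cancels the weight exactly.
    Integrability of [Z] justifies summing over the partition. *)
Lemma integral_randomization :
  (forall l, P.-integrable setT (EFin \o D l)) -> P.-integrable setT (EFin \o Z) ->
  (\int[P]_w (Z w)%:E = \sum_(l <oo) \int[P]_w (D l w)%:E)%E.
Proof.
move=> iD iZ; rewrite -[in LHS]bigcup_N integral_bigcup ?bigcup_N//.
apply: eq_eseriesr => l _.
have -> : (\int[P]_(w in N @^-1` [set l]) (Z w)%:E =
    \int[P]_(w in N @^-1` [set l]) (((p l)^-1)%:E * (D l w)%:E))%E.
  by apply: eq_integral => w; rewrite inE /= => ->; rewrite /= mulrC.
have mh : measurable_fun setT (fun x : R => (((p l)^-1)%:E * x%:E)%E).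
  by apply: measurable_funeM; exact/measurable_EFinP.
rewrite (integral_independent N_indep _ (mD l) mh)//; last first.
  exact: (integrableZl measurableT _ (iD l)).
rewrite [in X in (X * _)%E]N_law integralZl//; last exact: iD.
by rewrite muleA -EFinM divff ?mul1e// gt_eqF.
Qed.

End Randomization.

(** * The coupled chains and their estimators *)

Section Coupling.
Context (d dF dF' : measure_display) (T : measurableType d)
  (F : measurableType dF) (F' : measurableType dF')
  (R : realType) (P : probability T R)
  (g : F * F' -> F) (mg : measurable_fun setT g)
  (U : int -> {RV P >-> F'}) (iidU : iid U)
  (x0 : F) (f : F -> R) (mf : measurable_fun setT f)
  (f_sq : forall i : nat, f \o chain g U x0 i \in Lfun P 2%:E)
  (nu : nat -> R) (nu_gt0 : forall i : nat, 0 < nu i)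
  (nu_dec : nonincreasing_seq nu)
  (nu_sum : cvgn (series (nu_term nu)))
  (nu_bound : forall i m : nat,
    ('E_P[fun w => ((f (shifted_chain g U x0 i%:Z m%:Z w)
                    - f (chain g U x0 i w)) ^+ 2)%R] <= (nu i)%:E)%E).

Local Notation X i m := (fun w => f (shifted_chain g U x0 i%:Z m%:Z w)).
Local Notation sigmaU :=
  (g_sigma_algebraType (\bigcup_i g_sigma_algebra_preimage (U i))).

Lemma shifted_chain_nat (i m : nat) :
  shifted_chain g U x0 i%:Z m%:Z = chain_from g U x0 (- m%:Z) (i + m).
Proof. by rewrite /shifted_chain -PoszD absz_nat. Qed.

Lemma chain_nat (i : nat) : chain g U x0 i = chain_from g U x0 0 i.
Proof. by rewrite -shifted_chain0 shifted_chain_nat addn0 oppr0. Qed.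

Lemma sigma_family_shifted (i m : nat) :
  measurable_fun setT ((X i m) : sigmaU -> R).
Proof.
rewrite shifted_chain_nat; apply: (measurableT_comp mf).
exact: sigma_family_chain_from.
Qed.

Let mX i m : measurable_fun setT (X i m).
Proof. exact: sigma_family_measurable_fun (sigma_family_shifted i m). Qed.

Lemma integral_shifted (h : R -> \bar R) (i m : nat) : measurable_fun setT h ->
  (\int[P]_w h (X i m w) = \int[P]_w h (f (chain g U x0 (i + m) w)))%E.
Proof.
move=> mh; rewrite shifted_chain_nat chain_nat.
have mhf : measurable_fun setT (fun x : F * F => h (f x.1)).
  by apply: (measurableT_comp mh); exact: (measurableT_comp mf).
(* The second chain is a dummy of length 0; only the law of the first one matters. *)
have := integral_chain_from_shift iidU mg x0 (- m%:Z) 0 0 (i + m) 0 0 mhf.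
by rewrite !addr0.
Qed.

Lemma integral_sqr_increment_le (i m m' : nat) : (m <= m')%N ->
  (\int[P]_w ((X i m' w - X i m w) ^+ 2)%:E <= (nu (i + m)%N)%:E)%E.
Proof.
move=> mm'; apply: le_trans (nu_bound (i + m) (m' - m)).
rewrite unlock !shifted_chain_nat chain_nat le_eqVlt; apply/orP; left; apply/eqP.
have mh : measurable_fun setT (fun x : F * F => ((f x.1 - f x.2) ^+ 2)%:E).
  apply/measurable_EFinP/measurable_funX/measurable_funB.
  - exact: (measurableT_comp mf).
  - exact: (measurableT_comp mf).
(* Moving time forward by [m] sends the starting times [- m'] and [- m] to [- (m' - m)] and [0],
   while the lengths [i + m'] and [i + m] are kept. *)
have := integral_chain_from_shift iidU mg x0 (- m'%:Z) (- (m' - m)%N%:Z)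
  0 (i + m') (m' - m) (i + m) mh.
rewrite !addr0 addNr -addnA subnKC//.
by rewrite (_ : - m'%:Z + (m' - m)%N%:Z = - m%:Z)//; lia.
Qed.

Lemma Lfun_shifted (i m : nat) : X i m \in Lfun P 2%:E.
Proof.
apply: Lfun2_of_sqr => //.
rewrite (integral_shifted (h := fun x => (x ^+ 2)%:E)).
  exact: integral_sqr_lty (f_sq _).
exact/measurable_EFinP/measurable_funX.
Qed.

Let iX i m : P.-integrable setT (EFin \o X i m).
Proof. exact/Lfun1_integrable/Lfun2_1/Lfun_shifted. Qed.

(** [fine] would turn an infinite expectation into 0; [meanE] excludes that case by
    square-integrability. *)
Definition mean (h : nat) : R := fine 'E_P[f \o chain g U x0 h].

Lemma meanE (h : nat) : ('E_P[f \o chain g U x0 h] = (mean h)%:E)%E.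
Proof. by rewrite /mean fineK// expectation_fin_num//; exact/Lfun2_1/f_sq. Qed.

Lemma mean_shifted (i m : nat) : (\int[P]_w (X i m w)%:E = (mean (i + m))%:E)%E.
Proof. by rewrite -meanE unlock (integral_shifted (h := EFin)). Qed.

(** [X h m] has the law of the chain at time [h + m], so the difference of means is the mean of the
    coupled difference [Y], whose square is at most the second moment of [Y]. *)
Lemma mean_dist_le (h m : nat) : `|mean (h + m) - mean h| <= Num.sqrt (nu h).
Proof.
rewrite -sqrtr_sqr ler_wsqrtr// -lee_fin.
pose Y w := X h m w - X h 0 w.
have mY : measurable_fun setT Y by exact: measurable_funB.
have Y2 : (\int[P]_w (Y w ^+ 2)%:E <= (nu h)%:E)%E.
  by have := integral_sqr_increment_le h (leq0n m); rewrite addn0.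
apply: (le_trans _ Y2); apply: sqr_expectation_le.
  by apply: Lfun2_of_sqr => //; exact: le_lt_trans Y2 (ltry _).
rewrite unlock [LHS](integralB_EFin measurableT (iX h m) (iX h 0)).
by rewrite !mean_shifted addn0.
Qed.

(** Cauchy criterion: all means after time [n0] lie within [sqrt (nu n0)] of [mean n0]. *)
Lemma is_cvg_mean : cvgn mean.
Proof.
apply/cauchy_cvgP/cauchy_exP => e e0.
have nu_ge0 i := ltW (nu_gt0 i).
have /cvgrPdist_lt/(_ e e0)[n0 _ Hn0] := sqrt_nu_cvg0 nu_ge0 nu_dec nu_sum.
exists (mean n0); exists n0 => // h /= n0h.
rewrite /ball /= distrC -(subnKC n0h) (le_lt_trans (mean_dist_le _ _))//.
have := Hn0 n0 (leqnn _); rewrite /= sub0r normrN ger0_norm// sqrtr_ge0.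
Qed.

Variables (b' : nat -> nat).
Local Notation est := (estimator g U x0 f b').

Lemma sigma_family_estimator (k l : nat) :
  measurable_fun setT (est k l : sigmaU -> R).
Proof.
apply: measurable_funM => //; apply: measurable_sum => i.
exact: sigma_family_shifted.
Qed.

Lemma integrable_estimator (k l : nat) : P.-integrable setT (EFin \o est k l).
Proof.
have -> : EFin \o est k l = (fun w => ((k - b' k)%:R^-1)%:E *
    \sum_(b' k <= i < k) (X i (k * (2 ^ l - 1))%N w)%:E)%E.
  by apply/funext => w /=; rewrite sumEFin -EFinM.
by apply: integrableZl => //; apply: integrable_sum => // i _; exact: iX.
Qed.

Lemma integral_estimator (k l : nat) :
  (\int[P]_w (est k l w)%:E = ((k - b' k)%:R^-1 *
    \sum_(b' k <= i < k) mean (i + k * (2 ^ l - 1)))%:E)%E.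
Proof.
have -> : (\int[P]_w (est k l w)%:E = \int[P]_w (((k - b' k)%:R^-1)%:E *
    \sum_(b' k <= i < k) (X i (k * (2 ^ l - 1))%N w)%:E))%E.
  by apply: eq_integral => w _; rewrite sumEFin -EFinM.
rewrite integralZl//; last by apply: integrable_sum => // i _; exact: iX.
rewrite integral_sum//; last by move=> i; exact: iX.
rewrite EFinM -sumEFin; congr (_ * _)%E.
by apply: eq_bigr => i _; rewrite mean_shifted.
Qed.

(** For fixed [k] the average has a fixed number of terms, and each index [i + k * (2 ^ l - 1)]
    tends to infinity with [l]. *)
Lemma cvg_mean_estimator (k : nat) : (1 <= k)%N -> (2 * b' k <= k)%N ->
  (k - b' k)%:R^-1 * \sum_(b' k <= i < k) mean (i + k * (2 ^ l - 1))
    @[l --> \oo] --> limn mean.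
Proof.
move=> k0 bk; have kb : (0 < k - b' k)%N by lia.
rewrite (_ : limn mean = (k - b' k)%:R^-1 * \sum_(b' k <= i < k) limn mean).
  apply: cvgM; first exact: cvg_cst.
  apply: cvg_big => [|i _]; first exact: add_continuous.
  apply: (@cvg_comp _ _ _ (fun l => i + k * (2 ^ l - 1))%N mean _ \oo).
    apply/cvgnyPge => A; exists A => // l /= Al.
    have : (l < 2 ^ l)%N by exact: ltn_expl.
    nia.
  exact: is_cvg_mean.
by rewrite sumr_const_nat -[limn mean *+ _]mulr_natl mulrA mulVf ?mul1r// pnatr_eq0 -lt0n.
Qed.

Lemma integral_sqr_estimator_increment_le (k l : nat) :
  (\int[P]_w ((est k l.+1 w - est k l w) ^+ 2)%:E <=
   (((k - b' k)%:R^-1 *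
      \sum_(b' k <= i < k) Num.sqrt (nu (i + k * (2 ^ l - 1))%N)) ^+ 2)%:E)%E.
Proof.
pose a i w := X i (k * (2 ^ l.+1 - 1))%N w - X i (k * (2 ^ l - 1))%N w.
have -> : (\int[P]_w ((est k l.+1 w - est k l w) ^+ 2)%:E =
    \int[P]_w (((k - b' k)%:R^-1 * \sum_(b' k <= i < k) a i w) ^+ 2)%:E)%E.
  by apply: eq_integral => w _; rewrite /estimator -mulrBr -sumrB.
apply: integral_sqr_sum_le.
- by move=> i; exact: measurable_funB.
(* Strict positivity of [nu] makes the [sqrt (nu _)] admissible as weights, by which the weighted
   inequality divides. *)
- by move=> i; rewrite sqrtr_gt0.
- have le_shift : (k * (2 ^ l - 1) <= k * (2 ^ l.+1 - 1))%N.
    by rewrite leq_mul2l leq_sub2r ?orbT// leq_exp2l.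
  move=> i; rewrite sqr_sqrtr; last exact: ltW.
  exact: integral_sqr_increment_le.
Qed.


(** * Weighted sum of the second moments of the increments *)

Hypothesis b'_le : forall k : nat, (1 <= k)%N -> (2 * b' k <= k)%N.
Variables (p : nat -> R) (p_gt0 : forall l : nat, 0 < p l).

Let increment_bound (k l : nat) : R := ((k - b' k)%:R^-1 *
  \sum_(b' k <= i < k) Num.sqrt (nu (i + k * (2 ^ l - 1))%N)) ^+ 2.

Let nu_ge0 i : 0 <= nu i. Proof. exact: ltW. Qed.

Let increment_bound_early (k l : nat) : (1 <= k)%N ->
  k%:R * increment_bound k l <= 2 * nu_bar nu (b' k %/ 2) ^+ 2.
Proof.
move=> k0; apply: le_trans (early_blocks_bound nu_ge0 nu_dec _ k0 (b'_le k0)) _.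
have S0 : 0 <= \sum_(b' k %/ 2 <= i < k) nu_term nu i.
  by apply: sumr_ge0 => i _; exact: sqrtr_ge0.
have SV := sum_nu_term_le nu_sum (b' k %/ 2) k.
by rewrite ler_wpM2l// ler_pXn2r// nnegrE// (le_trans S0).
Qed.

Let increment_bound_late (k l : nat) : (1 <= k)%N -> (2 <= l)%N ->
  k%:R * increment_bound k l <= (2 : R) ^ (3 - l%:Z) *
    (nu_bar nu (k * 2 ^ (l - 2)) - nu_bar nu (k * 2 ^ (l - 1))) ^+ 2.
Proof.
move=> k0 l2; rewrite nu_bar_sub//; last first.
  by rewrite leq_mul2l leq_exp2l// leq_sub2l ?orbT.
exact (late_blocks_bound nu_ge0 nu_dec k0 (b'_le k0) l2).
Qed.

Lemma sum_increments_le (k : nat) : (1 <= k)%N ->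
  (k%:R%:E * \sum_(l <oo) ((p l)^-1)%:E *
     \int[P]_w ((est k l.+1 w - est k l w) ^+ 2)%:E <=
   second_moment_bound nu p b' k)%E.
Proof.
move=> k0; pose v l := k%:R * increment_bound k l / p l.
pose u l := (k%:R%:E * (((p l)^-1)%:E *
  \int[P]_w ((est k l.+1 w - est k l w) ^+ 2)%:E))%E.
have I0 l : (0 <= \int[P]_w ((est k l.+1 w - est k l w) ^+ 2)%:E)%E.
  by apply: integral_ge0 => w _; rewrite lee_fin sqr_ge0.
have p0 l : 0 <= (p l)^-1 by rewrite invr_ge0 ltW.
have u0 l : (0 <= u l)%E by rewrite !mule_ge0// lee_fin.
have uv l : (u l <= (v l)%:E)%E.
  rewrite /v mulrAC -mulrA !EFinM; do 2 (apply: lee_wpmul2l; first by rewrite lee_fin).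
  exact: integral_sqr_estimator_increment_le.
rewrite -nneseriesZl; last by move=> l _; rewrite mule_ge0// lee_fin.
(* Levels 0 and 1 give the two terms with [nu_bar nu (b' k %/ 2)]; the remaining levels are compared
   termwise with the series. *)
rewrite (nneseries_split 0 2) ?add0n; last by move=> l _; exact: u0.
apply: leeD.
  rewrite !big_nat_recr//= big_geq// add0e mulrDr EFinD; apply: leeD;
    apply: le_trans (uv _) _;
    by rewrite lee_fin ler_wpM2r// increment_bound_early.
apply: lee_lim.
- by apply: is_cvg_nneseries => l _ _; exact: u0.
- apply: is_cvg_nneseries => l _ _.
  by rewrite lee_fin mulr_ge0// mulr_ge0 ?sqr_ge0 ?exprz_ge0.
- apply: nearW => n; rewrite big_nat_cond [leRHS]big_nat_cond.
  apply: lee_sum => l /andP[/andP[l2 _] _]; apply: le_trans (uv _) _.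
  by rewrite lee_fin ler_wpM2r// increment_bound_late.
Qed.

End Coupling.

(** * Expected cost and assembly of the theorem *)

Lemma expected_time_le (R : realType) (p : nat -> R) (tau : nat -> nat -> R) (k : nat) :
  (forall l, 0 < p l) -> (forall l, 0 <= tau k l) ->
  (forall l, tau k l <= estimator_time R k l.+1 + estimator_time R k l) ->
  (expected_time p tau k <= (3 * k%:R)%:E * \sum_(l <oo) (2 ^+ l * p l)%:E)%E.
Proof.
move=> p0 tau0 tau_le; rewrite -nneseriesZl; last first.
  by move=> l _; rewrite lee_fin mulr_ge0 ?exprn_ge0// ltW.
apply: lee_nneseries => l _; first by move=> _; rewrite lee_fin mulr_ge0// ltW.
rewrite -EFinM lee_fin mulrA mulrC ler_wpM2r ?(ltW (p0 l))//.
rewrite (le_trans (tau_le l))// /estimator_time -natrD -natrX -!natrM ler_nat.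
by rewrite expnS; lia.
Qed.


Theorem lemma3p2 (d dF dF' : measure_display) (T : measurableType d)
  (F : measurableType dF) (F' : measurableType dF')
  (R : realType) (P : probability T R)
  (g : F * F' -> F) (mg : measurable_fun setT g)
  (U : int -> {RV P >-> F'}) (iidU : iid U)
  (x0 : F) (f : F -> R) (mf : measurable_fun setT f)
  (f_sq : forall i : nat, f \o chain g U x0 i \in Lfun P 2%:E)
  (b' : nat -> nat) (b'_le : forall k : nat, (1 <= k)%N -> (2 * b' k <= k)%N)
  (p : nat -> R) (p_gt0 : forall l : nat, 0 < p l)
  (p_sum1 : (\sum_(l <oo) (p l)%:E = 1)%E)
  (N : {RV P >-> nat}) (N_law : forall l : nat, P (N @^-1` [set l]) = (p l)%:E)
  (N_indep : independent_of_family N U)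
  (tau : nat -> nat -> R)
  (tau_ge0 : forall k l : nat, (1 <= k)%N -> 0 <= tau k l)
  (tau_le : forall k l : nat, (1 <= k)%N ->
    tau k l <= estimator_time R k l.+1 + estimator_time R k l)
  (nu : nat -> R) (nu_gt0 : forall i : nat, 0 < nu i)
  (nu_dec : nonincreasing_seq nu)
  (nu_sum : cvgn (series (nu_term nu)))
  (nu_bound : forall i m : nat,
    ('E_P[fun w => ((f (shifted_chain g U x0 i%:Z m%:Z w)
                    - f (chain g U x0 i w)) ^+ 2)%R] <= (nu i)%:E)%E) :
  exists mu : R,
    ('E_P[f \o chain g U x0 h] @[h --> \oo] --> mu%:E)%E /\
    forall k : nat, (1 <= k)%N ->
      let f0 := estimator g U x0 f b' k 0 in
      let Z := randomized_estimator g U x0 f b' p N k in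
      let bound := second_moment_bound nu p b' k in
      [/\ (expected_time p tau k <=
             (3 * k%:R)%:E * \sum_(l <oo) (2 ^+ l * p l)%:E)%E,
          (k%:R%:E * 'E_P[fun w => (Z w ^+ 2)%R] <= bound)%E &
          (bound < +oo)%E ->
            Z \in Lfun P 2%:E /\ ('E_P[fun w => (f0 w + Z w)%R] = mu%:E)%E].

Proof.
pose mu := limn (mean g U x0 f).
exists mu; split.
  rewrite (_ : (fun h => _) = EFin \o mean g U x0 f); last first.
    by apply/funext => h; rewrite /= -(meanE f_sq).
  apply: cvg_EFin; first by near=> h.
  exact: (is_cvg_mean mg iidU mf f_sq nu_gt0 nu_dec nu_sum nu_bound).
move=> k k1 f0 Z bound.
have k2 := b'_le k k1.
pose est := estimator g U x0 f b' k.
pose D l w := est l.+1 w - est l w.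
have mD l : measurable_fun setT
    (D l : g_sigma_algebraType (\bigcup_i g_sigma_algebra_preimage (U i)) -> R).
  by apply: measurable_funB; exact: sigma_family_estimator.
have mZ : measurable_fun setT Z := measurable_randomization N p mD.
have Z2E : (\int[P]_w (Z w ^+ 2)%:E =
    \sum_(l <oo) ((p l)^-1)%:E * \int[P]_w (D l w ^+ 2)%:E)%E.
  exact: (integral_sqr_randomization N_indep p_gt0 N_law (D := D) mD).
have kZ2 : (k%:R%:E * \int[P]_w (Z w ^+ 2)%:E <= bound)%E.
  rewrite Z2E; exact: sum_increments_le.
split.
- by apply: expected_time_le => // l; [exact: tau_ge0 | exact: tau_le].
- by rewrite unlock.
move=> bound_fin.
have Z2 : Z \in Lfun P 2%:E.
  apply: Lfun2_of_sqr => //.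
  (* An infinite second moment, multiplied by [k >= 1], would make the finite bound infinite. *)
  rewrite ltNge leye_eq; apply/negP => /eqP Zoo.
  move: (le_lt_trans kZ2 bound_fin); rewrite Zoo gt0_muley ?ltxx//.
  by rewrite lte_fin ltr0n.
split=> //.
have iest l : P.-integrable setT (EFin \o est l).
  exact: integrable_estimator.
have if0 : f0 \in Lfun P 1 by apply/Lfun1_integrable; exact: iest.
rewrite [LHS](expectationD if0 (Lfun2_1 Z2)) unlock.
(* [e l] is the mean of the estimator at level [l]; in particular [e 0] is that of [f0]. *)
pose e l := (k - b' k)%:R^-1 *
  \sum_(b' k <= i < k) mean g U x0 f (i + k * (2 ^ l - 1)).
have estE l : (\int[P]_w (est l w)%:E = (e l)%:E)%E.
  exact: integral_estimator.
have iD l : P.-integrable setT (EFin \o D l).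
  exact: (integrableB measurableT (iest l.+1) (iest l)).
have DE l : (\int[P]_w (D l w)%:E = (e l.+1 - e l)%:E)%E.
  by rewrite [LHS](integralB_EFin measurableT (iest l.+1) (iest l)) !estE.
(* The partial sums telescope to [e n - e 0], and [e n] tends to [mu]; adding the mean [e 0] of [f0]
   removes the bias. *)
have -> : (\int[P]_w (Z w)%:E = (mu - e 0)%:E)%E.
  have /Lfun1_integrable iZ := Lfun2_1 Z2.
  rewrite [LHS](integral_randomization N_indep p_gt0 N_law (D := D) mD iD iZ).
  apply/cvg_lim => //.
  rewrite (_ : (fun n => _) = (fun n => (e n - e 0)%:E)); last first.
    apply/funext => n; rewrite (eq_bigr (fun l => (e l.+1 - e l)%:E))//.
    by rewrite sumEFin telescope_sumr.
  apply: cvg_EFin; first by near=> h.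
  apply: cvgB; last exact: cvg_cst.
  exact: (cvg_mean_estimator mg iidU mf f_sq nu_gt0 nu_dec nu_sum nu_bound).
by rewrite estE -EFinD addrC subrK.
Unshelve. all: by end_near. Qed.
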